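(* Let $A$, $B$ be $\mathfrak F$-algebras, $M$, $N$ sets, $f:A\to{}^\star M$ a $T\star$-representation of $A$, $g:B\to{}^\star N$ a $T\star$-representation of $B$, and let $(r:A\to B,\ R:M\to N)$ be a morphism of $T\star$-representations from $f$ into $g$. Put $s=\ker r=\{(a_1,a_2)\in A\times A: r(a_1)=r(a_2)\}$ and $S=\ker R=\{(m_1,m_2)\in M\times M: R(m_1)=R(m_2)\}$. Then: (1) $s$ is a congruence on $A$, and $r$ decomposes as $r=i\,t\,j$, where $j:A\to A/s$ is the natural homomorphism, $t:A/s\to r(A)$, $t(j(a))=r(a)$, is an isomorphism of $\mathfrak F$-algebras, and $i:r(A)\to B$ is the inclusion. (2) $S$ is an equivalence on $M$, and $R$ decomposes as $R=I\,T\,J$, where $J:M\to M/S$ is the natural surjection, $T:M/S\to R(M)$, $T(J(m))=R(m)$, is a bijection, and $I:R(M)\to N$ is the inclusion. (3) There is a $T\star$-representation $F$ of the $\mathfrak F$-algebra $A/s$ in $M/S$ with $F(j(a))(J(m))=J(f(a)m)$ for all $a\in A$, $m\in M$. (4) There is a $T\star$-representation $G$ of the $\mathfrak F$-algebra $r(A)$ in $R(M)$ with $G(t(j(a)))(T(J(m)))=T(F(j(a))J(m))$ for all $a\in A$, $m\in M$. (5) $(j,J)$ is a morphism of $T\star$-representations from $f$ into $F$, $(t,T)$ is a morphism from $F$ into $G$, $(i,I)$ is a morphism from $G$ into $g$, and $(r,R)=(i,I)(t,T)(j,J)$.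
   Context: An $\mathfrak F$-algebra is an algebra of a fixed type (signature) $\mathfrak F$ in the sense of universal algebra; homomorphisms preserve all operations. A transformation of a set $M$ is a map $M\to M$; ${}^\star M$ denotes the set of transformations of $M$ acting from the left. A $T\star$-representation of an $\mathfrak F$-algebra $A$ in $M$ is a homomorphism of $\mathfrak F$-algebras $f:A\to{}^\star M$, where ${}^\star M$ is assumed to carry a structure of $\mathfrak F$-algebra; $f(a)m$ is the value of the transformation $f(a)$ at $m$. A morphism of $T\star$-representations from $f:A\to{}^\star M$ into $g:B\to{}^\star N$ is a pair $(r,R)$ of maps $r:A\to B$, $R:M\to N$ such that $r$ is a homomorphism of $\mathfrak F$-algebras and $R(f(a)m)=g(r(a))R(m)$ for all $a\in A$, $m\in M$. The product of morphisms is $(q,Q)(p,P)=(qp,QP)$ (composition, right factor applied first). The $\mathfrak F$-algebra operations on the transformations of $M/S$ and of $R(M)$ occurring here are the induced ones: for an $n$-ary operation $\omega$, $\omega(F(j(a_1)),\dots,F(j(a_n)))J(m)=J(\omega(f(a_1),\dots,f(a_n))m)$ and $\omega(G(r(a_1)),\dots,G(r(a_n)))R(m)=T(\omega(F(j(a_1)),\dots,F(j(a_n)))J(m))$. *)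

(* Defs.v *)
From Corelib Require RelationClasses.
From mathcomp Require Import all_boot.
From mathcomp Require Import boolp classical_sets.

Set Implicit Arguments.
Unset Strict Implicit.
Unset Printing Implicit Defensive.

Local Open Scope classical_set_scope.

Record signature := Signature { symbol : Type; arity : symbol -> nat }.

Definition operations (Sg : signature) (X : Type) : Type :=
  forall w : symbol Sg, ('I_(arity w) -> X) -> X.

Record algebra (Sg : signature) := Algebra {
  carrier :> Type;
  op : operations Sg carrier
}.

Definition is_hom (Sg : signature) (A B : algebra Sg) (h : A -> B) : Prop :=
  forall (w : symbol Sg) (x : 'I_(arity w) -> A),
    h (op x) = op (fun k => h (x k)).

Definition is_iso (Sg : signature) (A B : algebra Sg) (h : A -> B) : Prop :=
  is_hom h /\ bijective h.

Definition is_congruence (Sg : signature) (A : algebra Sg)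
    (s : A -> A -> Prop) : Prop :=
  RelationClasses.Equivalence s /\
  forall (w : symbol Sg) (x y : 'I_(arity w) -> A),
    (forall k, s (x k) (y k)) -> s (op x) (op y).

Definition ker (X Y : Type) (h : X -> Y) : X -> X -> Prop :=
  fun x1 x2 => h x1 = h x2.

Definition inclusion (Y : Type) (X : set Y) (x : X) : Y := val x.

Definition corestrict (X Y : Type) (h : X -> Y) (x : X) : range h :=
  SigSub (mem_set (imageT h x)).

Definition preimage_of (X Y : Type) (h : X -> Y) (y : range h) : X :=
  s2val (cid2 (set_mem (valP y))).

(* [X/S] is the set of the classes [{y | S x y}], hence the range of the map
   sending a point to its class, and the natural surjection is the
   corestriction of that map. *)
Definition class_of (X : Type) (S : X -> X -> Prop) (x : X) : set X :=
  [set y | S x y].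

Definition quotient (X : Type) (S : X -> X -> Prop) : Type :=
  range (class_of S).

Definition natural (X : Type) (S : X -> X -> Prop) (x : X) : quotient S :=
  corestrict (class_of S) x.

Definition representative (X : Type) (S : X -> X -> Prop) (c : quotient S) : X :=
  preimage_of c.

(* The operations are computed on chosen representatives; for an equivalence
   [s], they do not depend on this choice when [s] is a congruence. *)
Definition quotient_algebra (Sg : signature) (A : algebra Sg)
    (s : A -> A -> Prop) : algebra Sg :=
  @Algebra Sg (quotient s)
    (fun w x => natural s (op (fun k => representative (x k)))).

Definition op_closed (Sg : signature) (B : algebra Sg) (X : set B) : Prop :=
  forall (w : symbol Sg) (x : 'I_(arity w) -> B),
    (forall k, X (x k)) -> X (op x).

Lemma subalgebra_subproof (Sg : signature) (B : algebra Sg) (X : set B)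
    (clX : op_closed X) (w : symbol Sg) (x : 'I_(arity w) -> X) :
  op (fun k => val (x k)) \in X.
Proof. by apply/mem_set/clX => k; apply/set_mem/(valP (x k)). Qed.

Definition subalgebra (Sg : signature) (B : algebra Sg) (X : set B)
    (clX : op_closed X) : algebra Sg :=
  @Algebra Sg X (fun w x => SigSub (subalgebra_subproof clX x)).

Lemma op_closed_range (Sg : signature) (A B : algebra Sg) (h : A -> B) :
  is_hom h -> op_closed (range h).
Proof.
move=> hh w x xh; have [a ha] := choice (fun k => let: ex_intro2 a _ e := xh k in
  ex_intro (fun a => h a = x k) a e).
by exists (op a) => //; rewrite hh; congr op; apply/funext.
Qed.

Definition image_algebra (Sg : signature) (A B : algebra Sg) (h : A -> B)
    (hh : is_hom h) : algebra Sg :=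
  subalgebra (op_closed_range hh).

(* The map [X/(ker h) -> h(X)] sending the class of [x] to [h x]. *)
Definition ker_lift (X Y : Type) (h : X -> Y) (c : quotient (ker h)) : range h :=
  corestrict h (representative c).

(* The left transformations of [M]; [act f a m] is [f(a)m]. *)
Definition transformation (M : Type) : Type := M -> M.

Record Tstar_representation (Sg : signature) (A : algebra Sg) (M : Type)
    (oM : operations Sg (transformation M)) := TstarRepresentation {
  act :> A -> transformation M;
  act_hom : is_hom (B := Algebra oM) act
}.

Definition is_morphism (Sg : signature) (A B : algebra Sg) (M N : Type)
    (oM : operations Sg (transformation M))
    (oN : operations Sg (transformation N))
    (f : Tstar_representation A oM) (g : Tstar_representation B oN)
    (p : (A -> B) * (M -> N)) : Prop :=
  is_hom p.1 /\ forall (a : A) (m : M), p.2 (f a m) = g (p.1 a) (p.2 m).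

Lemma is_morphism_hom (Sg : signature) (A B : algebra Sg) (M N : Type)
    (oM : operations Sg (transformation M))
    (oN : operations Sg (transformation N))
    (f : Tstar_representation A oM) (g : Tstar_representation B oN)
    (r : A -> B) (R : M -> N) :
  is_morphism f g (r, R) -> is_hom r.
Proof. by case. Qed.

Definition morphism_prod (A B C M N P : Type)
    (q : (B -> C) * (N -> P)) (p : (A -> B) * (M -> N)) :
    (A -> C) * (M -> P) :=
  (q.1 \o p.1, q.2 \o p.2).

(* Main.v *)
Require Import Defs.
From Corelib Require RelationClasses.
From mathcomp Require Import all_boot.
From mathcomp Require Import boolp classical_sets.

Local Open Scope classical_set_scope.

(** The first isomorphism theorem, once for algebras and once for sets, gives
    the decompositions [r = i t j] and [R = I T J]; on points it rests on the
    fact that a chosen representative of the class of [x] modulo [ker h] has the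
    same value under [h] as [x] ([representative_ker]).

    The representations [F] and [G] come from one principle,
    [descend_representation].  Let [p : A -> A'] be a surjective homomorphism and
    [P : M -> M'] a surjection such that [P (f a m)] depends only on [p a] and
    [P m].  Then the rule [F (p a) (P m) = P (f a m)] defines [F] completely, and
    [F] preserves the operations as soon as those of the transformations of [M']
    are induced by those of the transformations of [M].  This is applied to
    [(j, J)] and to [(r, R)] with codomains cut down to the images: in both cases
    [p a] and [P m] carry the same information as [r a] and [R m], and
    [R (f a m) = g (r a) (R m)] is a function of these.

    The equations that make the three pairs morphisms need only be checked on
    values of the surjections, where they are the defining rules of [F] and
    [G]. *)

Lemma corestrict_preimage (X Y : Type) (h : X -> Y) (y : range h) :
  corestrict h (preimage_of y) = y.
Proof. by apply: val_inj; rewrite /= /preimage_of; case: cid2. Qed.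

Lemma natural_representative (X : Type) (S : X -> X -> Prop) (c : quotient S) :
  natural S (representative c) = c.
Proof. exact: corestrict_preimage. Qed.

Lemma corestrict_eq (X Y : Type) (h : X -> Y) (x y : X) :
  corestrict h x = corestrict h y <-> h x = h y.
Proof.
by split=> [/(congr1 val)|e] //; apply: val_inj.
Qed.

Lemma ker_equivalence (X Y : Type) (h : X -> Y) :
  RelationClasses.Equivalence (ker h).
Proof. by split=> [x|x y|x y z]; rewrite /ker // => -> . Qed.

Lemma ker_congruence (Sg : signature) (A B : algebra Sg) (h : A -> B) :
  is_hom h -> is_congruence (ker h).
Proof.
move=> hh; split; first exact: ker_equivalence.
by move=> w x y xy; rewrite /ker !hh; congr op; apply/funext.
Qed.

Lemma natural_ker_eq (X Y : Type) (h : X -> Y) (x y : X) :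
  natural (ker h) x = natural (ker h) y <-> h x = h y.
Proof.
rewrite /natural corestrict_eq; split=> [e|e].
  (* [y] lies in its own class, hence in that of [x]. *)
  by have : class_of (ker h) y y by []; rewrite -e.
by apply/seteqP; split=> z; rewrite /class_of /ker /= e.
Qed.

Lemma representative_ker (X Y : Type) (h : X -> Y) (x : X) :
  h (representative (natural (ker h) x)) = h x.
Proof. by apply/natural_ker_eq/natural_representative. Qed.

Lemma ker_lift_natural (X Y : Type) (h : X -> Y) (x : X) :
  ker_lift (natural (ker h) x) = corestrict h x.
Proof. exact/corestrict_eq/representative_ker. Qed.

Lemma ker_lift_bijective (X Y : Type) (h : X -> Y) :
  bijective (ker_lift (h := h)).
Proof.
exists (fun y => natural (ker h) (preimage_of y)) => [c|y].
  rewrite -[RHS]natural_representative; apply/natural_ker_eq/corestrict_eq.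
  exact: corestrict_preimage.
by rewrite ker_lift_natural corestrict_preimage.
Qed.

(** The operations of the quotient are computed on representatives, and a
    congruence makes the class of the result insensitive to them. *)
Lemma natural_hom (Sg : signature) (A B : algebra Sg) (h : A -> B) :
  is_hom h -> is_hom (natural (ker h) : A -> quotient_algebra (ker h)).
Proof.
move=> hh w x; apply/natural_ker_eq; rewrite !hh.
by congr op; apply/funext => k; rewrite representative_ker.
Qed.

Lemma corestrict_hom (Sg : signature) (A B : algebra Sg) (h : A -> B)
    (hh : is_hom h) :
  is_hom (corestrict h : A -> image_algebra hh).
Proof. by move=> w x; apply: val_inj; rewrite /= hh. Qed.

(** [ker_lift h] is [corestrict h] taken at representatives, and the operations of the
    quotient are computed at representatives too. *)
Lemma ker_lift_hom (Sg : signature) (A B : algebra Sg) (h : A -> B)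
    (hh : is_hom h) :
  is_hom (ker_lift (h := h) : quotient_algebra (ker h) -> image_algebra hh).
Proof.
by move=> w x; rewrite [LHS]ker_lift_natural (corestrict_hom _ _ _ _ hh).
Qed.

(** A representation passes to surjective images with which it is compatible.
    Sections [u] of [p] and [v] of [P] give [F]; compatibility frees its values
    from the choice of sections.  Every argument of [F] being some [p a], the
    hypothesis on the induced operations determines the operations on all values
    of [F], so that [F] is a homomorphism because [f] and [p] are. *)
Lemma descend_representation (Sg : signature) (A A' : algebra Sg) (M M' : Type)
    (oM : operations Sg (transformation M))
    (oM' : operations Sg (transformation M'))
    (f : Tstar_representation A oM) (p : A -> A') (P : M -> M')
    (u : A' -> A) (v : M' -> M) :
  is_hom p -> cancel u p -> cancel v P ->
  (forall a b m n, p a = p b -> P m = P n -> P (f a m) = P (f b n)) ->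
  (forall F : A' -> transformation M',
    (forall a m, F (p a) (P m) = P (f a m)) ->
    forall (w : symbol Sg) (a : 'I_(arity w) -> A) (m : M),
      oM' w (fun k => F (p (a k))) (P m) = P (oM w (fun k => f (a k)) m)) ->
  exists F : Tstar_representation A' oM',
    forall a m, F (p a) (P m) = P (f a m).
Proof.
move=> ph uK vK compat induced.
pose F (a : A') : transformation M' := fun m => P (f (u a) (v m)).
have FE a m : F (p a) (P m) = P (f a m) by apply: compat; rewrite ?uK ?vK.
suff Fh : is_hom (B := Algebra oM') F by exists (TstarRepresentation Fh).
move=> w x; apply/funext => m.
have xE : x = (fun k => p (u (x k))) by apply/funext => k; rewrite uK.
by rewrite xE -ph -[m]vK FE act_hom /= induced.
Qed.

Theorem theorem2p10 (Sg : signature) (A B : algebra Sg) (M N : Type)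
    (oM : operations Sg (transformation M))
    (oN : operations Sg (transformation N))
    (f : Tstar_representation A oM) (g : Tstar_representation B oN)
    (r : A -> B) (R : M -> N) (rR : is_morphism f g (r, R))
    (s := ker r) (S := ker R)
    (As := quotient_algebra s)
    (rA := image_algebra (is_morphism_hom rR))
    (j := natural s : A -> As)
    (t := ker_lift (h := r) : As -> rA)
    (i := inclusion (X := range r) : rA -> B)
    (J := natural S : M -> quotient S)
    (T := ker_lift (h := R) : quotient S -> range R)
    (I := inclusion (X := range R) : range R -> N)
    (* the algebra structures on the transformations of [M/S] and of [R(M)] *)
    (oQ : operations Sg (transformation (quotient S)))
    (oI : operations Sg (transformation (range R)))
    (* ... are the induced ones *)
    (oQ_induced : forall F : As -> transformation (quotient S),
      (forall a m, F (j a) (J m) = J (f a m)) ->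
      forall (w : symbol Sg) (a : 'I_(arity w) -> A) (m : M),
        oQ w (fun k => F (j (a k))) (J m) = J (oM w (fun k => f (a k)) m))
    (oI_induced : forall (F : As -> transformation (quotient S))
        (G : rA -> transformation (range R)),
      (forall a m, F (j a) (J m) = J (f a m)) ->
      (forall a m, G (t (j a)) (T (J m)) = T (F (j a) (J m))) ->
      forall (w : symbol Sg) (a : 'I_(arity w) -> A) (m : M),
        oI w (fun k => G (corestrict r (a k))) (corestrict R m) =
        T (oQ w (fun k => F (j (a k))) (J m))) :
  [/\ is_congruence s, is_hom j, (forall a, i (t (j a)) = r a),
      is_iso t & r = i \o t \o j] /\
  [/\ RelationClasses.Equivalence S, (forall c, exists m, J m = c),
      (forall m, I (T (J m)) = R m), bijective T & R = I \o T \o J] /\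
  exists F : Tstar_representation As oQ,
    (forall a m, F (j a) (J m) = J (f a m)) /\
    exists G : Tstar_representation rA oI,
      (forall a m, G (t (j a)) (T (J m)) = T (F (j a) (J m))) /\
      [/\ is_morphism f F (j, J), is_morphism F G (t, T),
          is_morphism G g (i, I) &
          (r, R) = morphism_prod (morphism_prod (i, I) (t, T)) (j, J)].
Proof.
have rh : is_hom r := is_morphism_hom rR.
have Rf a m : R (f a m) = g (r a) (R m) by have [_] := rR; apply.
have tj a : t (j a) = corestrict r a by exact: ker_lift_natural.
have TJ m : T (J m) = corestrict R m by exact: ker_lift_natural.
have jK c : exists a, j a = c.
  by exists (representative c); apply: natural_representative.
have JK c : exists m, J m = c.
  by exists (representative c); apply: natural_representative.
have jh : is_hom j by exact: natural_hom.
have th : is_hom t by exact: ker_lift_hom.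
have itj a : i (t (j a)) = r a by rewrite tj.
have ITJ m : I (T (J m)) = R m by rewrite TJ.
have rE : r = i \o t \o j by apply/funext => a; rewrite /= itj.
have RE : R = I \o T \o J by apply/funext => m; rewrite /= ITJ.
split.
  split=> //; first exact: ker_congruence.
  by split=> //; apply: ker_lift_bijective.
split.
  by split=> //; [apply: ker_equivalence | apply: ker_lift_bijective].
have [F FE] : exists F : Tstar_representation As oQ,
    forall a m, F (j a) (J m) = J (f a m).
  apply: (descend_representation _ _ _ _ _ _ _ f j J _ _ jh (@natural_representative _ _)
    (@natural_representative _ _)) => // a b m n /natural_ker_eq ab
    /natural_ker_eq mn.
  by apply/natural_ker_eq; rewrite !Rf ab mn.
exists F; split=> //.
have [G GE] : exists G : Tstar_representation rA oI,
    forall a m, G (corestrict r a) (corestrict R m) = corestrict R (f a m).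
  apply: (descend_representation _ _ _ _ _ _ _ f (corestrict r : A -> rA) (corestrict R) _ _
    (corestrict_hom _ _ _ _ _) (@corestrict_preimage _ _ _)
    (@corestrict_preimage _ _ _)) => [a b m n|G GE w a m].
    by move=> /corestrict_eq ab /corestrict_eq mn; apply/corestrict_eq;
      rewrite !Rf ab mn.
  rewrite (oI_induced F G FE) ?(oQ_induced F FE) ?TJ //.
  by move=> b n; rewrite tj TJ FE TJ.
have GF a m : G (t (j a)) (T (J m)) = T (F (j a) (J m)).
  by rewrite tj TJ FE TJ.
exists G; split=> //; split.
- by split=> //= a m; rewrite FE.
- split=> //= c d; have [a <-] := jK c; have [m <-] := JK d.
  by rewrite GF.
- split=> //= b n.
  rewrite -[b]corestrict_preimage -[n]corestrict_preimage GE.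
  exact: Rf.
- by rewrite /morphism_prod /= -rE -RE.
Qed.
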